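(* For Matching in the Late Accept/Reject model, the competitive ratio is at least $3/2$; that is, for every real $c<3/2$, no online algorithm in the Late Accept/Reject model is $c$-competitive.
   Context: Online Matching (edge arrival). An input $\sigma$ is a finite simple undirected graph $G=(V,E)$ together with an ordering of its edges. Edges arrive one by one in this order; endpoints not seen before are revealed with the edge. All online algorithms are deterministic: each decision depends only on the part of the input revealed so far. After each arrival the algorithm maintains a set of currently accepted edges, which must be a matching (pairwise non-incident edges). $\mathrm{ALG}(\sigma)$ is the number of accepted edges at the end of the input, and $\mathrm{OPT}(\sigma)$ is the maximum cardinality of a matching in $G$; the objective is maximization. Late Accept/Reject model: in each step the algorithm may accept the newly arrived edge and any earlier edges that have not been late-rejected, and it may remove (late-reject) accepted edges; a late-rejected edge can never be accepted again. An algorithm $\mathrm{ALG}$ is $c$-competitive if there is a constant $\alpha$ such that $\mathrm{OPT}(\sigma)\le c\,\mathrm{ALG}(\sigma)+\alpha$ for all inputs $\sigma$. The competitive ratio of the problem is the infimum of all $c$ for which some online algorithm is $c$-competitive. *)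

(* Defs.v *)
From HB Require Import structures.
From mathcomp Require Import all_boot all_order all_algebra finmap.
From mathcomp Require Import all_classical all_reals ereal.
Set Implicit Arguments.
Unset Strict Implicit.
Unset Printing Implicit Defensive.
Import Order.TTheory GRing.Theory Num.Theory.

Local Open Scope ring_scope.

(* An undirected edge is the two-element set of its endpoints; vertices are
   named by natural numbers, which serve only as identifiers. *)
Definition edge : choiceType := {fset nat}.

Record input := Input {
  vertices : {fset nat};
  edges : seq edge;
  edges_uniq : uniq edges;
  edges_wf : all (fun e : edge =>
    (e `<=` vertices)%fset && (#|` e| == 2)%N) edges }.

Definition matching (M : {fset edge}) : bool :=
  [forall e : M, [forall f : M,
    (val e != val f) ==> [disjoint val e & val f]%fset]].

Definition OPT (s : input) : nat :=
  (\max_(M <- fpowerset [fset e in edges s]%fset | matching M) #|` M|)%N.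

(* A deterministic online algorithm maps the sequence of edges revealed so far
   to the set of edges accepted after processing the last of them. Its own past
   decisions need not be passed to it, since the prefix determines them. *)
Definition online_algorithm := seq edge -> {fset edge}.

Definition accepted (A : online_algorithm) (s : input) (i : nat) : {fset edge} :=
  A (take i (edges s)).

Definition late_rejected (A : online_algorithm) (s : input) (i : nat) :
    {fset edge} :=
  (\bigcup_(j <- iota 0 i) (accepted A s j `\` accepted A s j.+1))%fset.

(* Earlier edges may be accepted at any step, and accepted edges dropped at any
   step; what is forbidden is to hold an edge that has been dropped before. *)
Definition late_accept_reject (A : online_algorithm) : Prop :=
  forall (s : input) (i : nat), (i <= size (edges s))%N ->
    [/\ (accepted A s i `<=` [fset e in take i (edges s)])%fset,
        [disjoint accepted A s i & late_rejected A s i]%fset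
      & matching (accepted A s i)].

Definition ALG (A : online_algorithm) (s : input) : nat :=
  #|` accepted A s (size (edges s))|.

Definition competitive (R : realType) (A : online_algorithm) (c : R) : Prop :=
  exists alpha : R, forall s : input,
    (OPT s)%:R <= c * (ALG A s)%:R + alpha.

(* The infimum is taken in the extended reals, where that of the empty set is
   +oo; the real-valued inf would return 0 there. *)
Definition competitive_ratio (R : realType) : \bar R :=
  ereal_inf [set c%:E | c in
    [set c : R | exists A, late_accept_reject A /\ competitive A c]]%classic.

(* Main.v *)
(** The adversary plays on [n] disjoint gadgets, each a growing path. It reveals
    the middle edge first. Whenever that edge is accepted, the adversary adds one
    edge on either side; whenever the edge is dropped afterwards, which is
    irrevocable, it adds one more edge on either side. When no gadget asks for a
    reaction any more, a gadget extended [t] times, [t <= 2], is a path of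
    [2 t + 1] edges: it contributes [t + 1] to OPT but at most [t] to ALG, because
    the middle edge is accepted precisely when [t = 1]. Hence [3 ALG <= 2 OPT]
    while [OPT >= n], and [n] is arbitrary. *)
Require Import Defs.
From mathcomp Require Import all_boot all_order all_algebra finmap.
From mathcomp Require Import all_classical all_reals ereal.
From mathcomp Require Import zify lra.
Import Order.TTheory GRing.Theory Num.Theory.
Local Open Scope ring_scope.

(** * Edges of the path on the natural numbers, and their matchings *)

Section PathEdges.
Local Open Scope nat_scope.

(** All gadgets are cut out of one infinite path, so an edge is named by its left endpoint and
    incidence becomes arithmetic. *)
Definition path_edge (v : nat) : edge := [fset v; v.+1]%fset.

Lemma in_path_edge v x : (x \in path_edge v) = (x == v) || (x == v.+1).
Proof. by rewrite !inE. Qed.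

Lemma path_edge_inj : injective path_edge.
Proof.
move=> v w /fsetP eq_vw.
have := eq_vw v; have := eq_vw w; rewrite !in_path_edge; lia.
Qed.

Lemma path_edge_disjoint v w :
  [disjoint path_edge v & path_edge w]%fset = (v.+1 < w) || (w.+1 < v).
Proof.
apply/fdisjointP/idP => [dis_vw | far_vw x]; last by rewrite !in_path_edge; lia.
have := dis_vw v; have := dis_vw v.+1; rewrite !in_path_edge; lia.
Qed.

Lemma matchingP (M : {fset edge}) :
  reflect {in M &, forall e f, e != f -> [disjoint e & f]%fset} (matching M).
Proof.
apply: (iffP forallP) => [matM e f eM fM ef | matM e].
  by have /forallP/(_ [` fM]%fset)/implyP := matM [` eM]%fset; apply.
by apply/forallP=> f; apply/implyP; apply: matM; apply: fsvalP.
Qed.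

Lemma path_edge_consecutive M v : matching M ->
  path_edge v \in M -> path_edge v.+1 \in M -> false.
Proof.
move=> /matchingP matM vM wM.
have := matM _ _ vM wM; rewrite path_edge_disjoint (inj_eq path_edge_inj); lia.
Qed.

Lemma path_input vs : uniq vs -> exists s, edges s = map path_edge vs.
Proof.
move=> uniq_vs.
have uniq_es : uniq (map path_edge vs) by rewrite map_inj_uniq //; exact: path_edge_inj.
pose V := [fset x in flatten [seq [:: v; v.+1] | v <- vs]]%fset.
have wf_es : all (fun e : edge => (e `<=` V)%fset && (#|` e| == 2)) (map path_edge vs).
  apply/allP=> _ /mapP[v v_vs ->]; rewrite cardfs2 neq_ltn ltnSn andbT.
  apply/fsubsetP=> x xv; rewrite inE; apply/flatten_mapP; exists v => //.
  by move: xv; rewrite in_path_edge !inE.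
by exists (Input uniq_es wf_es).
Qed.

Lemma leq_OPT s (M : {fset edge}) :
  {subset M <= edges s} -> matching M -> #|` M| <= OPT s.
Proof.
move=> sMs matM; apply: leq_bigmax_seq => //.
by rewrite fpowersetE; apply/fsubsetP=> e /sMs; rewrite inE.
Qed.

End PathEdges.

(** * The adversary against a Late Accept/Reject algorithm *)

Section LateAcceptReject.
Local Open Scope nat_scope.
Variable A : online_algorithm.
Hypothesis lar : late_accept_reject A.

Lemma lar_dropped s i j e : i <= j <= size (edges s) ->
  e \in accepted A s i -> e \notin accepted A s j -> e \in late_rejected A s j.
Proof.
case/andP=> le_ij le_js ei; elim: j le_ij le_js => [|j IHj] le_ij le_js ej.
  by move: ej; rewrite (_ : 0 = i) ?ei //; lia.
rewrite /late_rejected; apply/bigfcupP.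
case ej': (e \in accepted A s j).
  by exists j; rewrite ?inE ?ej' ?ej // mem_iota; lia.
have le_ij' : i <= j.
  by rewrite leqNgt; apply/negP => lt_ji; move: ej; rewrite (_ : j.+1 = i) ?ei //; lia.
have /bigfcupP[h] := IHj le_ij' (ltnW le_js) (negbT ej').
rewrite mem_iota andbT => h_lt eh; exists h => //; rewrite mem_iota; lia.
Qed.

(** The three sequences are prefixes of one input, along which the late-rejected set only grows
    while staying disjoint from the accepted set. *)
Lemma lar_not_reaccepted us vs ws e : uniq (us ++ vs ++ ws) ->
  e \in A (map path_edge us) -> e \notin A (map path_edge (us ++ vs)) ->
  e \notin A (map path_edge (us ++ vs ++ ws)).
Proof.
move=> /path_input[s def_s] e_us e_vs.
have size_s : size (edges s) = size us + (size vs + size ws).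
  by rewrite def_s size_map !size_cat.
have acc_us : accepted A s (size us) = A (map path_edge us).
  by rewrite /accepted def_s -map_take take_size_cat.
have acc_vs : accepted A s (size us + size vs) = A (map path_edge (us ++ vs)).
  by rewrite /accepted def_s -map_take catA take_size_cat // size_cat.
have acc_ws : accepted A s (size (edges s)) = A (map path_edge (us ++ vs ++ ws)).
  by rewrite /accepted take_size def_s.
have [_ dis _] := lar s (size (edges s)) (leqnn _).
have e_rej : e \in late_rejected A s (size us + size vs).
  by apply: (@lar_dropped s (size us)); rewrite ?acc_us ?acc_vs // size_s; lia.
rewrite -acc_ws; apply: contraL e_rej => e_ws.
have /negP := fdisjointP dis _ e_ws; apply: contra_notN => /bigfcupP[h h_lt eh].
apply/bigfcupP; exists h => //; move: h_lt; rewrite !mem_iota; lia.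
Qed.

Lemma lar_accepted vs : uniq vs ->
  {subset A (map path_edge vs) <= map path_edge vs} /\
  matching (A (map path_edge vs)).
Proof.
move=> /path_input[s def_s].
have [/fsubsetP sub _] := lar s (size (edges s)) (leqnn _).
rewrite /accepted take_size def_s in sub *; split=> // e /sub; by rewrite inE.
Qed.

(* Gadget [k] lives on the vertices 6k, ..., 6k+5 and [middle k] is its central
   edge; after [t] extensions it consists of the [path_edge (6k + j)] with
   [2 - t <= j <= 2 + t]. *)
Definition middle k := path_edge (6 * k + 2).

Definition revealed (t : nat) : pred nat := fun j => 2 - t <= j <= 2 + t.

(** [state_accepted] remembers a past acceptance, so that a later drop is known to be irrevocable;
    [state_rejected] ranges over all continuations, so it survives further moves. *)
Record adversary_state n (vs : seq nat) (t : nat -> nat) : Prop := {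
  state_uniq : uniq vs;
  state_mem : forall v, (v \in vs) = (v < 6 * n) && revealed (t (v %/ 6)) (v %% 6);
  state_le2 : forall k, t k <= 2;
  state_accepted : forall k, k < n -> t k = 1 -> exists us ws,
    vs = us ++ ws /\ middle k \in A (map path_edge us);
  state_rejected : forall k, k < n -> t k = 2 -> forall ws, uniq (vs ++ ws) ->
    middle k \notin A (map path_edge (vs ++ ws)) }.

Lemma adversary_init n :
  adversary_state n [seq 6 * k + 2 | k <- iota 0 n] (fun=> 0).
Proof.
split=> // [|v].
  by rewrite map_inj_uniq ?iota_uniq // => k l; lia.
apply/mapP/idP => [[k] | v_mid].
  by rewrite mem_iota /revealed => k_lt ->; lia.
by exists (v %/ 6); rewrite ?mem_iota; move: v_mid; rewrite /revealed; lia.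
Qed.

(** The [!=] says that gadget [k] calls for a reaction: its middle edge is accepted at [t k = 0] or
    missing at [t k = 1]. At [t k = 2] that edge is lost for good, so no call occurs. *)
Lemma adversary_step n vs t k : adversary_state n vs t -> k < n ->
  (middle k \in A (map path_edge vs)) != (t k == 1) ->
  t k < 2 /\
  adversary_state n (vs ++ [:: 6 * k + 1 - t k; 6 * k + 3 + t k])
                    (fun l => t l + (l == k)).
Proof.
case=> Uvs mem_vs le2 acc rej lt_kn react.
have lt_tk : t k < 2.
  have := le2 k; rewrite leq_eqVlt => /predU1P[t2|//].
  by move: (rej k lt_kn t2 [::]) react; rewrite cats0 t2 => /(_ Uvs)/negPf->.
set new := [:: _; _].
have mem_new v : (v \in new) = (v == 6 * k + 1 - t k) || (v == 6 * k + 3 + t k).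
  by rewrite !inE.
have Unew : uniq (vs ++ new).
  rewrite cat_uniq Uvs /= !inE orbF !mem_vs /revealed.
  have -> : (6 * k + 1 - t k) %/ 6 = k by lia.
  have -> : (6 * k + 3 + t k) %/ 6 = k by lia.
  lia.
split=> //; split=> // [v|l|l lt_ln|l lt_ln].
- rewrite mem_cat mem_new mem_vs /revealed.
  have := divn_eq v 6; have := ltn_mod v 6; have := le2 k.
  have [-> /= | ne_vk] := eqVneq (v %/ 6) k; first by lia.
  by rewrite addn0; lia.
- by have := le2 l; have [->|_] := eqVneq l k; lia.
- have [-> /= tk1 | _] := eqVneq l k; last first.
    rewrite addn0 => /(acc _ lt_ln)[us [ws [-> us_acc]]].
    by exists us, (ws ++ new); rewrite catA.
  exists vs, new; split=> //; move: react; have -> : t k = 0 by lia.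
  by case: (_ \in _).
- have [-> /= tk2 | _] := eqVneq l k => [ws Uws|]; last first.
    rewrite addn0 => tl2 ws Uws; rewrite -catA; apply: rej => //.
    by rewrite catA.
  have tk1 : t k = 1 by lia.
  have [us [ws' [def_vs us_acc]]] := acc _ lt_kn tk1.
  have {react} vs_rej : middle k \notin A (map path_edge vs).
    by move: react; rewrite tk1; case: (_ \in _).
  rewrite def_vs -!catA in Uws vs_rej *.
  exact: lar_not_reaccepted.
Qed.

Lemma adversary_final n : exists vs t, adversary_state n vs t /\
  forall k, k < n -> (middle k \in A (map path_edge vs)) = (t k == 1).
Proof.
move: (adversary_init n); move: (map _ _) (fun=> 0) => vs t.
(* The number of extensions still available drops with each reaction, so the play ends. *)
have [m] := ubnP (\sum_(k < n) (2 - t k)).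
elim: m vs t => // m IHm vs t lt_m st.
case: (pickP (fun k : 'I_n =>
    (middle k \in A (map path_edge vs)) != (t k == 1))) => [k react | quiet]; last first.
  exists vs, t; split=> // k lt_kn.
  by have /negbFE/eqP := quiet (Ordinal lt_kn).
have [lt_tk st'] := adversary_step _ _ _ _ st (ltn_ord k) react.
apply: (IHm _ _ _ st'); rewrite ltnS in lt_m; apply: leq_trans lt_m.
rewrite (bigD1 k) // [X in _ < X](bigD1 k) //= eqxx -addSn leq_add //; first lia.
by apply: leq_sum => l ne_lk; lia.
Qed.

End LateAcceptReject.

(** * Counting accepted and optimal edges gadget by gadget *)

Section Counting.
Local Open Scope nat_scope.

Lemma sum_gadgets n (F : nat -> nat) :
  \sum_(v <- iota 0 (6 * n)) F v =
  \sum_(k < n) \sum_(j <- iota 0 6) F (6 * k + j).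
Proof.
elim: n => [|n IHn]; first by rewrite muln0 big_nil big_ord0.
rewrite mulnS (addnC 6) iotaD big_cat IHn big_ord_recr; congr (_ + _).
by rewrite addnC iotaDl big_map.
Qed.

Lemma ALG_bound A n vs t : late_accept_reject A -> adversary_state A n vs t ->
  (forall k, k < n -> (middle k \in A (map path_edge vs)) = (t k == 1)) ->
  #|` A (map path_edge vs)| <= \sum_(k < n) t k.
Proof.
move=> lar [Uvs mem_vs le2 _ _] final.
have [sub mat] := lar_accepted _ lar _ Uvs; set M := A _ in final sub mat *.
have inM v : path_edge v \in M -> (v < 6 * n) && revealed (t (v %/ 6)) (v %% 6).
  by move=> /sub; rewrite (mem_map path_edge_inj) mem_vs.
have consec v := path_edge_consecutive M v mat.
apply: leq_trans (_ : size [seq path_edge v | v <- iota 0 (6 * n) &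
                            path_edge v \in M] <= _).
  apply: uniq_leq_size; first exact: fset_uniq.
  move=> e eM; have /mapP[v v_vs def_e] := sub _ eM; rewrite def_e map_f //.
  rewrite mem_filter -def_e eM mem_iota.
  by move: v_vs; rewrite mem_vs => /andP[].
rewrite size_map size_filter -sum1_count big_mkcond sum_gadgets.
apply: leq_sum => k _; rewrite unlock /= addn0.
have {final} := final k (ltn_ord k); rewrite /middle.
have := le2 k.
have inMk j : j < 6 -> path_edge (6 * k + j) \in M -> revealed (t k) j.
  move=> lt_j6 /inM; have -> : (6 * k + j) %/ 6 = k by lia.
  by (have -> : (6 * k + j) %% 6 = j by lia); case/andP.
have := inMk 0 isT; have := inMk 1 isT; have := inMk 3 isT.
have := inMk 4 isT; have := inMk 5 isT.
have := consec (6 * k + 0); have := consec (6 * k + 1); have := consec (6 * k + 2).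
have := consec (6 * k + 3); rewrite -!addnS !addn0 /revealed.
(* For [t k = 0] the only edge is not accepted; for [t k = 1] the middle edge blocks both
   neighbours; for [t k = 2], without the middle edge, two pairs of incident edges remain. *)
do 6![case: (_ \in M)] => /=; lia.
Qed.

Lemma OPT_bound A n vs t s : adversary_state A n vs t ->
  edges s = map path_edge vs -> \sum_(k < n) (t k).+1 <= OPT s.
Proof.
move=> [Uvs mem_vs le2 _ _] def_s.
(* Both end edges, at [2 - t] and [2 + t], have the parity of [t]: every second edge is taken,
   starting from an end. *)
pose sel v := revealed (t (v %/ 6)) (v %% 6) && ~~ odd (v %% 6 + t (v %/ 6)).
pose es := [seq path_edge v | v <- iota 0 (6 * n) & sel v].
have Ues : uniq es.
  by rewrite map_inj_uniq ?filter_uniq ?iota_uniq //; exact: path_edge_inj.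
have <- : #|` [fset e in es]%fset| = \sum_(k < n) (t k).+1.
  rewrite card_fseq undup_id // size_map size_filter -sum1_count big_mkcond.
  rewrite sum_gadgets; apply: eq_bigr => k _; rewrite unlock /= addn0.
  have selk j : j < 6 -> sel (6 * k + j) = revealed (t k) j && ~~ odd (j + t k).
    move=> lt_j6; rewrite /sel; have -> : (6 * k + j) %/ 6 = k by lia.
    by have -> : (6 * k + j) %% 6 = j by lia.
  have := selk 0 isT; rewrite addn0 => ->.
  by rewrite !selk //; have := le2 k; case: (t k) => [|[|[|]]].
apply: leq_OPT => [e | ].
  rewrite inE def_s => /mapP[v]; rewrite mem_filter mem_iota => /andP[/andP[rev_v _] lt_v] ->.
  by rewrite map_f // mem_vs rev_v andbT.
apply/matchingP=> e f; rewrite !inE.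
move=> /mapP[v]; rewrite mem_filter => /andP[selv _] ->.
move=> /mapP[w]; rewrite mem_filter => /andP[selw _] ->.
rewrite (inj_eq path_edge_inj) path_edge_disjoint.
move: selv selw; rewrite /sel /revealed; have := le2 (v %/ 6); have := le2 (w %/ 6).
have := divn_eq v 6; have := divn_eq w 6.
by have [-> | ] := eqVneq (v %/ 6) (w %/ 6); lia.
Qed.

End Counting.

(** * From the counts to the competitive ratio *)

Lemma adversary_input A n : late_accept_reject A ->
  exists s, (3 * ALG A s <= 2 * OPT s)%N /\ (n <= OPT s)%N.
Proof.
move=> lar; have [vs [t [st final]]] := adversary_final _ lar n.
have [s def_s] := path_input _ (state_uniq _ _ _ _ st).
have := ALG_bound _ _ _ _ lar st final; have := OPT_bound _ _ _ _ _ st def_s.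
have -> : #|` A (map path_edge vs)| = ALG A s.
  by rewrite /ALG /accepted take_size def_s.
have -> : (\sum_(k < n) (t k).+1 = \sum_(k < n) t k + n)%N.
  by under eq_bigr do rewrite -addn1; rewrite big_split /= sum_nat_const card_ord muln1.
(* With [T] the sum of the [t k], this gives [3 ALG <= 3 T <= 2 (T + n) <= 2 OPT]. *)
have : (\sum_(k < n) t k <= 2 * n)%N.
  rewrite mulnC -[n in (n * _)%N]card_ord -sum_nat_const.
  by apply: leq_sum => k _; exact: state_le2 _ _ _ _ st k.
by exists s; lia.
Qed.

Lemma late_accept_reject_not_competitive (R : realType) (c : R) A :
  c < 3 / 2 -> late_accept_reject A -> ~ competitive A c.
Proof.
move=> c_lt lar [alpha comp].
(* Chosen so that [c * ALG <= (1 - d) * OPT], with the maximum covering negative [c]; an OPT beyond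
   [alpha / d] then defeats [alpha]. *)
pose d := 1 - 2 / 3 * Num.max c 0.
have d_gt0 : 0 < d by rewrite /d; case: (ltP c 0); lra.
have [s [le_alg le_opt]] := adversary_input A (Num.bound `|alpha / d|) lar.
have := comp s; apply/negP; rewrite -ltNge.
have alg_opt : 3 * (ALG A s)%:R <= 2 * (OPT s)%:R :> R.
  by rewrite -!natrM ler_nat.
have alg_ge0 : 0 <= (ALG A s)%:R :> R by [].
have : alpha < d * (OPT s)%:R.
  rewrite mulrC -ltr_pdivrMr //.
  apply: lt_le_trans (_ : (Num.bound `|alpha / d|)%:R <= _); last by rewrite ler_nat.
  by rewrite (le_lt_trans (ler_norm _)) // archi_boundP.
by rewrite /d; case: (ltP c 0) => c0; nra.
Qed.

Theorem theorem8 (R : realType) :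
  ((3 / 2 : R)%:E <= competitive_ratio R)%E /\
  (forall c : R, c < 3 / 2 ->
     forall A : online_algorithm, late_accept_reject A -> ~ competitive A c).
Proof.
split=> [|c c_lt A]; last exact: late_accept_reject_not_competitive.
apply/ereal_infP => _ [c [A [lar comp]] <-]; rewrite lee_fin leNgt.
by apply/negP => c_lt; exact: late_accept_reject_not_competitive comp.
Qed.
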